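(* Let $n \ge 1$ and let $f$ be a real-valued orthogonally invariant function on the space of real symmetric $n \times n$ matrices, so that $f(M) = g(\lambda_1(M), \dots, \lambda_n(M))$ for every symmetric $M$, where $\lambda_1(M), \dots, \lambda_n(M)$ are the eigenvalues of $M$ and $g : \mathbb{R}^n \to \mathbb{R}$ is a symmetric function. Then $f$ is convex on the space of real symmetric $n \times n$ matrices if and only if $g$ is convex on $\mathbb{R}^n$.
   Context: A function $f$ on the space of real symmetric $n \times n$ matrices is orthogonally invariant if $f(O M O^{T}) = f(M)$ for every symmetric $M$ and every orthogonal $n \times n$ matrix $O$. A function $g : \mathbb{R}^n \to \mathbb{R}$ is symmetric if $g(\lambda_1, \dots, \lambda_n) = g(\lambda_{\sigma(1)}, \dots, \lambda_{\sigma(n)})$ for every permutation $\sigma$ of $\{1, \dots, n\}$ and all $(\lambda_1,\dots,\lambda_n) \in \mathbb{R}^n$. Eigenvalues are listed with multiplicity; since $g$ is symmetric the order of listing is irrelevant. Every orthogonally invariant $f$ factors through the spectrum in the stated form, and $g$ is the restriction of $f$ to diagonal matrices, i.e. $g(\lambda_1, \dots, \lambda_n) = f(\mathrm{diag}(\lambda_1, \dots, \lambda_n))$. *)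

(* Defs.v *)
From HB Require Import structures.
From mathcomp Require Import all_boot all_order all_algebra all_fingroup.
From mathcomp Require Import classical_sets reals convex.

Set Implicit Arguments.
Unset Strict Implicit.
Unset Printing Implicit Defensive.

Import GRing.Theory.
Local Open Scope ring_scope.

(* Functions on the space of symmetric matrices are represented by functions
   on all of 'M[R]_n, of which only the values on [symmetric_matrices R n]
   are ever used. *)
Definition symmetric_matrices (R : realType) (n : nat) : set 'M[R]_n :=
  [set M : 'M[R]_n | M \is symmetricmx]%classic.
Arguments symmetric_matrices : clear implicits.

Definition orthogonal_matrix (R : realType) (n : nat) (O : 'M[R]_n) : Prop :=
  O *m O^T = 1%:M.

Definition orthogonally_invariant (R : realType) (n : nat)
    (f : 'M[R]_n -> R) : Prop :=
  forall M O : 'M[R]_n, M \is symmetricmx -> orthogonal_matrix O ->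
    f (O *m M *m O^T) = f M.

Definition symmetric_function (R : realType) (n : nat)
    (g : 'rV[R]_n -> R) : Prop :=
  forall (s : 'S_n) (l : 'rV[R]_n), g (col_perm s l) = g l.

(* [l] lists the eigenvalues of [M] with multiplicity, in an arbitrary order. *)
Definition eigenvalue_list (R : realType) (n : nat)
    (M : 'M[R]_n) (l : 'rV[R]_n) : Prop :=
  char_poly M = \prod_(i < n) ('X - (l 0 i)%:P).

Definition function_of_eigenvalues (R : realType) (n : nat)
    (f : 'M[R]_n -> R) (g : 'rV[R]_n -> R) : Prop :=
  forall (M : 'M[R]_n) (l : 'rV[R]_n),
    M \is symmetricmx -> eigenvalue_list M l -> f M = g l.

(* Main.v *)
Require Import Defs.
From HB Require Import structures.
From mathcomp Require Import all_boot all_order all_algebra all_fingroup.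
From mathcomp Require Import classical_sets reals convex.
From mathcomp Require Import interval_inference complex ring.

Set Implicit Arguments.
Unset Strict Implicit.
Unset Printing Implicit Defensive.

Import Order.TTheory GRing.Theory Num.Theory.
Local Open Scope ring_scope.

(** The direct implication is the restriction of [f] to diagonal matrices: the
    map [diag_mx] is linear and [f (diag_mx l) = g l].

    For the converse, the heart is the inequality [convex_diagonal_le]: if [g]
    is convex and symmetric, then [g (diagonal (O M O^T)) <= f M] for every
    symmetric [M] and orthogonal [O].  Indeed, by the spectral theorem
    [real_spectral], [O M O^T = Q (diag_mx l) Q^T] with [Q] orthogonal and [l]
    the eigenvalues of [M]; its diagonal is the image of [l] by the matrix of
    the squares of the entries of [Q], which is doubly stochastic
    (Schur's observation), and a symmetric convex function does not increase
    under doubly stochastic matrices ([symmetric_convex_doubly_stochastic], a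
    consequence of Birkhoff's decomposition into permutation matrices).

    Given symmetric [A] and [B], let [O] diagonalize [C = t A + (1 - t) B].  The
    eigenvalues of [C] are the diagonal of [O C O^T], hence the combination of
    the diagonals of [O A O^T] and [O B O^T]; convexity of [g], then the
    inequality above applied to [A] and to [B], give
    [f C <= t f A + (1 - t) f B]. *)

(** * Doubly stochastic matrices *)

(** Square matrices with nonnegative entries whose rows and columns all sum to
    one. *)
Definition doubly_stochastic (R : realFieldType) (n : nat)
    (S : 'M[R]_n) : Prop :=
  [/\ forall i j, 0 <= S i j,
      forall i, \sum_j S i j = 1 &
      forall j, \sum_i S i j = 1].

(** The support of a doubly stochastic matrix contains a permutation.  Take a
    permutation [s] that meets the support as often as possible.  If it misses
    it at row [i0], consider the rows reachable from [i0] when [i] is joined to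
    [k] whenever row [i] could take over the column [s k] of row [k].  Counting
    the mass of rows and of columns shows that [i0] is on a cycle, and rotating
    [s] along this cycle improves it. *)
Lemma doubly_stochastic_diagonal (R : realFieldType) (n : nat) (S : 'M[R]_n) :
  doubly_stochastic S -> exists s : 'S_n, forall i, 0 < S i (s i).
Proof.
case=> S_ge0 S_row S_col.
case: (@arg_maxnP _ (1%g : 'S_n) xpredT
  (fun s : 'S_n => #|[set i | 0 < S i (s i)]|)) => // s _ s_max.
exists s => i0; rewrite lt_neqAle S_ge0 andbT eq_sym.
apply: contraT => /negPn/eqP Si0.
pose e : rel 'I_n := fun i k => 0 < S i (s k).
pose X := [set k | connect e i0 k].
have X_i0 : i0 \in X by rewrite inE connect0.
have rowX i : i \in X -> \sum_(k in X) S i (s k) = 1.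
  move=> Xi; rewrite -(S_row i) [RHS](reindex_inj (@perm_inj _ s)) /=.
  rewrite [RHS](bigID (mem X)) /= [X in _ = _ + X]big1 ?addr0 // => k.
  apply: contraNeq; move: Xi; rewrite !inE => Xi Sik.
  by apply: connect_trans Xi (connect1 _); rewrite /e lt_neqAle eq_sym Sik /=.
(* Summed by rows, the block on rows [X] and columns [s X] has mass [#|X|],
   which is the whole mass of these columns; so column [s i0], one of them,
   vanishes outside of the rows [X]. *)
have colX : \sum_(k in X) \sum_(i in X) S i (s k)
            = \sum_(k in X) \sum_i S i (s k).
  rewrite exchange_big /=; under eq_bigr => i Xi do rewrite rowX //.
  by under [RHS]eq_bigr => k _ do rewrite S_col.
have col0 : \sum_(i | i \notin X) S i (s i0) = 0.
  have: \sum_(k in X) \sum_(i | i \notin X) S i (s k) = 0.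
    apply: (@addrI _ (\sum_(k in X) \sum_(i in X) S i (s k))).
    rewrite addr0 {2}colX -big_split /=; apply: eq_bigr => k _.
    by rewrite [RHS](bigID (mem X)).
  move/psumr_eq0P; apply=> // k _; exact: sumr_ge0.
have [j Xj e_j] : exists2 j, j \in X & e j i0.
  have: \sum_(i in X) S i (s i0) != 0.
    suff -> : \sum_(i in X) S i (s i0) = 1 by rewrite oner_eq0.
    by have := S_col (s i0); rewrite (bigID (mem X)) /= [X in _ + X]col0 addr0.
  rewrite psumr_neq0 // => /hasP[j _ /andP[Xj Sj]].
  by exists j.
move: Xj; rewrite inE => /connectP[p0 e_p0 j_last].
move: e_j; rewrite {}j_last; case/shortenP: e_p0 => p e_p uniq_p _ e_last.
have cyc : path.cycle e (i0 :: p) by rewrite /= rcons_path e_p.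
(* On the cycle each row takes the column of its successor; off the cycle
   [next] is the identity. *)
pose c := perm (can_inj (prev_next uniq_p)).
have /(_ (c * s)%g isT) := s_max.
rewrite /= leqNgt => /negP[]; apply: proper_card; apply/properP; split.
  apply/fintype.subsetP => i; rewrite !inE permM permE.
  have [p_i _|p'i] := boolP (i \in i0 :: p); first exact: (next_cycle cyc p_i).
  by rewrite next_nth (negPf p'i).
exists i0; rewrite inE ?Si0 ?ltxx // permM permE.
exact: (next_cycle cyc (mem_head _ _)).
Qed.

(** * Symmetric convex functions *)

Lemma convex_functionE (R : realType) (E : lmodType R)
    (D : set E) (f : E -> R) :
  convex_function D f <->
  forall (t : R) (x y : E), 0 <= t <= 1 -> D x -> D y ->
    f (t *: x + (1 - t) *: y) <= t * f x + (1 - t) * f y.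
Proof.
split=> [cf t x y /andP[t_ge0 t_le1] Dx Dy | cf t x y /set_mem Dx /set_mem Dy].
  exact: (cf (Itv01 t_ge0 t_le1) x y (mem_set Dx) (mem_set Dy)).
by apply: cf => //; rewrite ge0 le1.
Qed.

(** By induction on the size of the support of [S]: if [s] is a permutation
    contained in the support and [th] is the least entry of [S] along [s],
    then either [S] is the matrix of [s], or [S = th * s + (1 - th) * T] with
    [T] doubly stochastic of smaller support. *)
Lemma symmetric_convex_doubly_stochastic (R : realType) (n : nat)
    (g : 'rV[R]_n -> R) (S : 'M[R]_n) (y : 'rV[R]_n) :
  symmetric_function g -> convex_function [set: 'rV[R]_n]%classic g ->
  doubly_stochastic S -> g (y *m S) <= g y.
Proof.
move=> g_sym /convex_functionE g_cvx.
pose supp (T : 'M[R]_n) := [set ij : 'I_n * 'I_n | T ij.1 ij.2 != 0].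
have [k] := ubnP #|supp S|; elim: k S => // k IHk S; rewrite ltnS => le_k dsS.
have [s s_gt0] := doubly_stochastic_diagonal dsS.
have [S_ge0 S_row S_col] := dsS.
have g_perm : g (y *m perm_mx s) = g y by rewrite -[s]invgK -col_permE g_sym.
have [->|neqS] := eqVneq S (perm_mx s); first by rewrite g_perm.
have n_gt0 : (0 < n)%N.
  rewrite lt0n; apply: contraNneq neqS => n0; apply/eqP/matrixP => -[i lt_i_n].
  by exfalso; rewrite n0 in lt_i_n.
pose i1 := Ordinal n_gt0.
case: (@arg_minP _ _ _ i1 xpredT (fun i => S i (s i))) => // i0 _ s_min.
set th := S i0 (s i0) in s_min.
have th_gt0 : 0 < th := s_gt0 i0.
have sum_perm_row i : \sum_j perm_mx s i j = 1 :> R.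
  rewrite (bigD1 (s i)) //= big1 ?addr0 ?mxE ?eqxx // => j.
  by rewrite !mxE eq_sym => /negPf->.
have sum_perm_col j : \sum_i perm_mx s i j = 1 :> R.
  rewrite (bigD1 (s^-1%g j)) //= big1 ?addr0 ?mxE ?permKV ?eqxx // => i.
  by rewrite !mxE -(can_eq (permK s)) permKV => /negPf->.
have DE i j : (S - th *: perm_mx s) i j = S i j - th * perm_mx s i j.
  by rewrite !mxE.
have D_ge0 i j : 0 <= (S - th *: perm_mx s) i j.
  rewrite !mxE; case: eqP => [<-|_]; last by rewrite mulr0 subr0.
  by rewrite mulr1 subr_ge0 s_min.
have D_row i : \sum_j (S - th *: perm_mx s) i j = 1 - th.
  under eq_bigr => j _ do rewrite DE.
  by rewrite sumrB S_row -mulr_sumr sum_perm_row mulr1.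
have D_col j : \sum_i (S - th *: perm_mx s) i j = 1 - th.
  under eq_bigr => i _ do rewrite DE.
  by rewrite sumrB S_col -mulr_sumr sum_perm_col mulr1.
(* If [th = 1], the nonnegative matrix [S - s] has null row sums, so [S] is the
   matrix of [s]. *)
have th_lt1 : th < 1.
  rewrite lt_neqAle -[th <= 1]subr_ge0 -(D_row i0) sumr_ge0 // andbT.
  apply: contraNneq neqS => th1; rewrite -subr_eq0; apply/eqP/matrixP => i j.
  have /psumr_eq0P D0 : \sum_j (S - th *: perm_mx s) i j = 0.
    by rewrite D_row th1 subrr.
  have := D0 (fun j _ => D_ge0 i j) j isT.
  by rewrite th1 scale1r => ->; rewrite mxE.
have th'_gt0 : 0 < 1 - th by rewrite subr_gt0.
pose T := (1 - th)^-1 *: (S - th *: perm_mx s).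
have dsT : doubly_stochastic T.
  split=> [i j|i|j].
  - by rewrite mxE mulr_ge0 // invr_ge0 ltW.
  - under eq_bigr => j _ do rewrite [T _ _]mxE.
    by rewrite -mulr_sumr D_row mulVf // gt_eqF.
  - under eq_bigr => i _ do rewrite [T _ _]mxE.
    by rewrite -mulr_sumr D_col mulVf // gt_eqF.
have S_eq : y *m S = th *: (y *m perm_mx s) + (1 - th) *: (y *m T).
  rewrite /T -scalemxAr scalerA mulfV ?gt_eqF // scale1r mulmxBr -scalemxAr.
  by rewrite addrC subrK.
have supp_lt : (#|supp T| < #|supp S|)%N.
  apply: proper_card; apply/properP; split.
    apply/fintype.subsetP => -[i j]; rewrite !inE /= !mxE.
    case: (s i =P j) => [<- _|_]; first by rewrite gt_eqF ?s_gt0.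
    by rewrite mulr0 subr0 mulf_eq0 negb_or => /andP[].
  exists (i0, s i0); rewrite inE /=; first by rewrite gt_eqF.
  by rewrite /T !mxE /= eqxx mulr1 subrr mulr0 eqxx.
have gT := IHk T (leq_trans supp_lt le_k) dsT.
rewrite S_eq; apply: le_trans (g_cvx _ _ _ _ _ _) _ => //.
  by rewrite !ltW.
rewrite g_perm -[leRHS]mul1r -[in leRHS](subrKC th 1) [leRHS]mulrDl lerD2l.
by rewrite ler_pM2l.
Qed.

(** * Spectral theorem for real symmetric matrices *)

Lemma symmetricmxE (R : realType) (n : nat) (M : 'M[R]_n) :
  (M \is symmetricmx) = (M^T == M).
Proof. by rewrite qualifE /= expr0 scale1r map_mx_id // eq_sym. Qed.

(** A complex eigenvalue [z] of a real symmetric matrix is real: with [w] the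
    conjugate of an eigenvector [v], computing [v M w^T] in two ways gives
    [z (v w^T) = z^* (v w^T)]. *)
Lemma symmetric_real_eigenvector (R : rcfType) (n : nat) (M : 'M[R]_n) :
  (0 < n)%N -> M^T = M ->
  exists a, exists2 v : 'rV[R]_n, v *m M = a *: v & v != 0.
Proof.
move=> n_gt0 M_sym; pose iota : {rmorphism R -> R[i]} := real_complex R.
pose N := map_mx iota M.
have [z N_z] := eigenvalue_closed N n_gt0.
have NC : map_mx Num.conj N = N.
  apply/matrixP => i j; rewrite !mxE; apply/CrealP/complex_realP.
  by exists (M i j).
suff z_real : z \is Num.real.
  have /complex_realP[a z_a] := z_real.
  move: N_z; rewrite z_a (eigenvalue_map iota) => /eigenvalueP[v vM v_neq0].
  by exists a; exists v.
case/eigenvalueP: N_z => v vN v_neq0.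
pose w := map_mx Num.conj v.
have NT : N^T = N by rewrite /N map_trmx M_sym.
have wN : N *m w^T = Num.conj z *: w^T.
  by rewrite -{1}NT -trmx_mul -{1}NC -map_mxM vN map_mxZ linearZ.
have vw_neq0 : (v *m w^T) 0 0 != 0.
  apply: contraNneq v_neq0; rewrite mxE => /psumr_eq0P vw0.
  apply/eqP/rowP => j; apply/eqP.
  rewrite [X in _ == X]mxE -normr_eq0 -sqrf_eq0 normCK.
  by have := vw0 _ j isT; rewrite !mxE => -> // k _; rewrite !mxE mul_conjC_ge0.
apply/CrealP; apply: (mulIf vw_neq0).
have : (v *m N) *m w^T = v *m (N *m w^T) by rewrite mulmxA.
rewrite vN wN -scalemxAl -scalemxAr => /(congr1 (fun A : 'M_1 => A 0 0)).
by rewrite mxE [RHS]mxE.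
Qed.

Lemma orthogonal_tr (R : realType) (n : nat) (O : 'M[R]_n) :
  orthogonal_matrix O -> O^T *m O = 1%:M.
Proof. exact: mulmx1C. Qed.

Lemma orthogonal_mul (R : realType) (n : nat) (O P : 'M[R]_n) :
  orthogonal_matrix O -> orthogonal_matrix P -> orthogonal_matrix (O *m P).
Proof.
rewrite /orthogonal_matrix trmx_mul mulmxA => OO PP.
by rewrite -(mulmxA O) PP mulmx1.
Qed.

Lemma row_sqnorm_gt0 (R : realFieldType) (n : nat) (v : 'rV[R]_n) :
  v != 0 -> 0 < (v *m v^T) 0 0.
Proof.
move=> v_neq0; have vv : (v *m v^T) 0 0 = \sum_j v 0 j ^+ 2.
  by rewrite mxE; apply: eq_bigr => j _; rewrite mxE expr2.
rewrite vv lt_neqAle sumr_ge0 ?andbT => [|j _]; last exact: sqr_ge0.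
apply: contraNneq v_neq0 => /esym/psumr_eq0P v0.
apply/eqP/rowP => j; rewrite mxE; apply/eqP; rewrite -sqrf_eq0 v0 // => k _.
exact: sqr_ge0.
Qed.

(** Every unit row vector is the first row of an orthogonal matrix: the
    reflection that exchanges it with the first basis vector, or the identity
    if the two coincide. *)
Lemma orthogonal_first_row (R : realType) (n : nat) (u : 'rV[R]_n.+1) :
  u *m u^T = 1%:M -> exists2 H : 'M[R]_n.+1, orthogonal_matrix H & row 0 H = u.
Proof.
move=> u_unit; pose e : 'rV[R]_n.+1 := delta_mx 0 0; pose w := u - e.
have [w0|w_neq0] := eqVneq w 0.
  exists 1%:M; first by rewrite /orthogonal_matrix trmx1 mulmx1.
  by rewrite row1; apply/esym/eqP; rewrite -subr_eq0 -/e -/w w0.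
have ee : e *m e^T = 1%:M.
  rewrite trmx_delta mul_delta_mx; apply/matrixP => i j.
  by rewrite !ord1 !mxE.
have ue : u *m e^T = (u 0 0)%:M.
  rewrite trmx_delta -colE; apply/matrixP => i j.
  by rewrite !ord1 !mxE ?eqxx ?mulr1n.
have eu : e *m u^T = (u 0 0)%:M.
  by rewrite -[e *m _]trmxK trmx_mul trmxK ue tr_scalar_mx.
pose q : R := 1 - u 0 0.
have ww : w *m w^T = (2 * q)%:M.
  rewrite /w linearB /= mulmxBr !mulmxBl u_unit ue eu ee -!raddfB /=.
  congr (_%:M); rewrite /q; ring.
have ew : e *m w^T = (- q)%:M.
  by rewrite /w linearB /= mulmxBr eu ee -raddfB opprB.
have q_neq0 : q != 0.
  have := row_sqnorm_gt0 w_neq0; rewrite ww mxE mulr1n.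
  by apply: contraTneq => ->; rewrite mulr0 ltxx.
(* As [w w^T = 2 q], the matrix [1 - q^-1 w^T w] is the reflection along [w]. *)
pose W := w^T *m w.
have WW : W *m W = (2 * q) *: W.
  by rewrite /W mulmxA -(mulmxA w^T) ww mul_mx_scalar scalemxAl.
have WT : W^T = W by rewrite trmx_mul trmxK.
exists (1%:M - q^-1 *: W).
  rewrite /orthogonal_matrix [(_ - _)^T]linearB /= [(_ *: W)^T]linearZ /=.
  rewrite trmx1 WT.
  rewrite mulmxBr mulmx1 mulmxBl mul1mx -scalemxAr -scalemxAl WW !scalerA.
  have -> : q^-1 / q * (2 * q) = q^-1 + q^-1 by field.
  by rewrite scalerDl opprB addrK subrK.
rewrite rowE mulmxBr mulmx1 -scalemxAr mulmxA ew mul_scalar_mx scalerA.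
by rewrite mulrN mulVf // scaleN1r opprK addrC subrK.
Qed.

Lemma symmetric_block_diagonal (R : nzRingType) (n : nat)
    (N : 'M[R]_(1 + n)) (a : R) :
  N^T = N -> row 0 N = a *: delta_mx 0 0 -> N = block_mx a%:M 0 0 (drsubmx N).
Proof.
move=> N_sym rowN; have NE j : N 0 j = a * (j == 0)%:R.
  by move/rowP: rowN => /(_ j); rewrite !mxE.
have ur0 : ursubmx N = 0.
  by apply/matrixP => i j; rewrite !mxE ord1 lshift0 NE mulr0.
rewrite -[LHS]submxK ur0 -[dlsubmx N]trmxK trmx_dlsub N_sym ur0 trmx0.
congr block_mx; apply/matrixP => i j.
by rewrite !mxE !ord1 lshift0 NE eqxx mulr1.
Qed.

(** By induction on the dimension: complete a unit eigenvector to an orthogonal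
    matrix [H]; then [H M H^T] is block diagonal, with blocks of sizes [1] and [n]. *)
Theorem real_spectral (R : realType) (n : nat) (M : 'M[R]_n) :
  M^T = M -> exists O : 'M[R]_n, exists2 l : 'rV[R]_n,
    orthogonal_matrix O & M = O^T *m diag_mx l *m O.
Proof.
elim: n M => [|n IHn] M M_sym.
  exists 1%:M, 0; first by rewrite /orthogonal_matrix trmx1 mulmx1.
  by rewrite [LHS]flatmx0 [RHS]flatmx0.
have [a [v vM v_neq0]] := symmetric_real_eigenvector (ltn0Sn n) M_sym.
pose c := (v *m v^T) 0 0.
have c_gt0 : 0 < c := row_sqnorm_gt0 v_neq0.
have vv : v *m v^T = c%:M by exact: mx11_scalar.
pose u := (Num.sqrt c)^-1 *: v.
have u_unit : u *m u^T = 1%:M.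
  rewrite /u linearZ /= -scalemxAl -scalemxAr vv scalerA scale_scalar_mx.
  by rewrite -invfM -expr2 sqr_sqrtr ?ltW // mulVf ?gt_eqF.
have uM : u *m M = a *: u by rewrite /u -scalemxAl vM !scalerA mulrC.
have [H H_orth rowH] := orthogonal_first_row u_unit.
pose N : 'M[R]_(1 + n) := H *m M *m H^T.
have N_sym : N^T = N by rewrite /N !trmx_mul trmxK M_sym mulmxA.
have rowN : row 0 N = a *: delta_mx 0 0.
  rewrite !rowE !mulmxA -rowE rowH uM -scalemxAl -rowH rowE -mulmxA H_orth.
  by rewrite mulmx1.
have N_block := symmetric_block_diagonal N_sym rowN.
have N'_sym : (drsubmx N)^T = drsubmx N by rewrite trmx_drsub N_sym.
have [P [l P_orth N'_eq]] := IHn _ N'_sym.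
pose Q : 'M[R]_(1 + n) := block_mx 1%:M 0 0 P.
have Q_orth : orthogonal_matrix (Q : 'M_n.+1).
  rewrite /orthogonal_matrix -[LHS]/(Q *m Q^T) /Q tr_block_mx mulmx_block.
  rewrite !trmx0 trmx1 !mulmx0 !mul0mx.
  by rewrite mul1mx P_orth !addr0 add0r -scalar_mx_block.
pose r : 'rV[R]_(1 + n) := row_mx a%:M l.
have N_eq : N = Q^T *m diag_mx r *m Q.
  rewrite N_block N'_eq diag_mx_row tr_block_mx !mulmx_block !trmx0 trmx1.
  rewrite !(mulmx0, mul0mx, mul1mx, mulmx1, addr0, add0r).
  by congr block_mx; apply/matrixP => i j; rewrite !ord1 !mxE ?eqxx ?mulr1n.
exists (Q *m H), r; first exact: orthogonal_mul.
have -> : M = H^T *m N *m H.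
  rewrite /N !mulmxA (orthogonal_tr H_orth) mul1mx -mulmxA.
  by rewrite (orthogonal_tr H_orth) mulmx1.
by rewrite N_eq trmx_mul !mulmxA.
Qed.

Lemma eigenvalue_list_orthogonal (R : realType) (n : nat)
    (O : 'M[R]_n) (l : 'rV[R]_n) :
  orthogonal_matrix O -> eigenvalue_list (O^T *m diag_mx l *m O) l.
Proof.
move=> O_orth; rewrite /eigenvalue_list.
have -> : \prod_(i < n) ('X - (l 0 i)%:P) = char_poly (diag_mx l).
  rewrite char_poly_trig ?diag_mx_is_trig //.
  by apply: eq_bigr => i _; rewrite mxE eqxx.
pose c : 'M[R]_n -> 'M[{poly R}]_n := map_mx polyC.
have cOO : c O^T *m c O = 1%:M.
  by rewrite -map_mxM (orthogonal_tr O_orth) map_mx1.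
have eq_c : char_poly_mx (O^T *m diag_mx l *m O)
            = c O^T *m char_poly_mx (diag_mx l) *m c O.
  rewrite /char_poly_mx !map_mxM mulmxBr mulmxBl; congr (_ - _).
  by rewrite mul_mx_scalar -scalemxAl cOO scalemx1.
by rewrite /char_poly eq_c !det_mulmx mulrAC -det_mulmx cOO det1 mul1r.
Qed.

(** * Diagonals and eigenvalues *)

(** The transposed indices make this matrix act on row vectors of eigenvalues
    from the right. *)
Lemma orthogonal_sq_doubly_stochastic (R : realType) (n : nat) (Q : 'M[R]_n) :
  orthogonal_matrix Q -> doubly_stochastic (\matrix_(i, j) Q j i ^+ 2).
Proof.
move=> Q_orth; split=> [i j|i|j].
- by rewrite mxE sqr_ge0.
- move/matrixP: (orthogonal_tr Q_orth) => /(_ i i).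
  rewrite !mxE eqxx mulr1n => <-.
  by apply: eq_bigr => j _; rewrite !mxE expr2.
- move/matrixP: Q_orth => /(_ j j); rewrite !mxE eqxx mulr1n => <-.
  by apply: eq_bigr => i _; rewrite !mxE expr2.
Qed.

(** The diagonal entries of a matrix, as a row vector. *)
Definition diagonal (R : realType) (n : nat) (M : 'M[R]_n) : 'rV[R]_n :=
  \row_i M i i.

Lemma diagonal_conj (R : realType) (n : nat) (Q : 'M[R]_n) (l : 'rV[R]_n) :
  diagonal (Q *m diag_mx l *m Q^T) = l *m \matrix_(i, j) Q j i ^+ 2.
Proof.
apply/rowP => i; rewrite !mxE; apply: eq_bigr => j _.
by rewrite mul_mx_diag !mxE mulrAC -expr2 mulrC.
Qed.

(** Schur's inequality, in functional form: the diagonal of a symmetric matrix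
    in any orthonormal basis is majorized by its eigenvalues. *)
Lemma convex_diagonal_le (R : realType) (n : nat)
    (f : 'M[R]_n -> R) (g : 'rV[R]_n -> R) (M O : 'M[R]_n) :
  symmetric_function g -> function_of_eigenvalues f g ->
  convex_function [set: 'rV[R]_n]%classic g ->
  M \is symmetricmx -> orthogonal_matrix O ->
  g (diagonal (O *m M *m O^T)) <= f M.
Proof.
move=> g_sym fg g_cvx M_sym O_orth.
have := M_sym; rewrite symmetricmxE => /eqP /real_spectral[P [l P_orth M_eq]].
have -> : f M = g l.
  by apply: fg => //; rewrite M_eq; exact: eigenvalue_list_orthogonal.
have -> : O *m M *m O^T = (O *m P^T) *m diag_mx l *m (O *m P^T)^T.
  by rewrite M_eq trmx_mul trmxK !mulmxA.
rewrite diagonal_conj; apply: symmetric_convex_doubly_stochastic => //.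
apply/orthogonal_sq_doubly_stochastic/orthogonal_mul => //.
by rewrite /orthogonal_matrix trmxK; exact: orthogonal_tr.
Qed.

Lemma diagonal_conv (R : realType) (n : nat) (t : R) (A B : 'M[R]_n) :
  diagonal (t *: A + (1 - t) *: B) = t *: diagonal A + (1 - t) *: diagonal B.
Proof. by apply/rowP => i; rewrite !mxE. Qed.

(** * Convexity of spectral functions *)

Theorem mainTheorem1 (R : realType) (n : nat) (n_ge1 : (1 <= n)%N)
    (f : 'M[R]_n -> R) (g : 'rV[R]_n -> R)
    (f_inv : orthogonally_invariant f)
    (g_sym : symmetric_function g)
    (fg : function_of_eigenvalues f g) :
  convex_function (symmetric_matrices R n) f <->
  convex_function [set: 'rV[R]_n]%classic g.
Proof.
split=> [/convex_functionE f_cvx | g_cvx]; apply/convex_functionE.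
  have diag_sym (l : 'rV[R]_n) : diag_mx l \is symmetricmx.
    by rewrite symmetricmxE tr_diag_mx.
  have f_diag l : f (diag_mx l) = g l.
    apply: fg => //; rewrite -[diag_mx l]mulmx1 -[diag_mx l]mul1mx -{1}trmx1.
    apply: eigenvalue_list_orthogonal.
    by rewrite /orthogonal_matrix trmx1 mulmx1.
  move=> t x y t01 _ _; rewrite -!f_diag linearD !linearZ /=.
  by apply: f_cvx => //; exact: diag_sym.
move=> t A B t01 A_sym B_sym.
have C_sym : t *: A + (1 - t) *: B \is symmetricmx.
  move: A_sym B_sym; rewrite /symmetric_matrices /= !symmetricmxE.
  by move=> /eqP AT /eqP BT; rewrite linearD !linearZ /= AT BT.
have := C_sym; rewrite symmetricmxE => /eqP /real_spectral[O [l O_orth C_eq]].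
rewrite (fg _ l C_sym); last by rewrite C_eq; exact: eigenvalue_list_orthogonal.
have l_eq : l = t *: diagonal (O *m A *m O^T)
                + (1 - t) *: diagonal (O *m B *m O^T).
  rewrite -diagonal_conv.
  have -> : t *: (O *m A *m O^T) + (1 - t) *: (O *m B *m O^T)
            = O *m (t *: A + (1 - t) *: B) *m O^T.
    by rewrite mulmxDr mulmxDl -!scalemxAr -!scalemxAl.
  rewrite C_eq !mulmxA O_orth mul1mx -mulmxA O_orth mulmx1.
  by apply/rowP => i; rewrite !mxE eqxx.
have /convex_functionE/(_ t _ _ t01 I I) := g_cvx.
rewrite [in X in g X <= _]l_eq => /(_ _ _)/le_trans; apply.
case/andP: t01 => t_ge0 t_le1.
by apply: lerD; apply: ler_wpM2l; rewrite ?subr_ge0 //;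
  apply: convex_diagonal_le.
Qed.
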